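(* A linear map $\phi:\mathfrak{m}_0\to\mathfrak{m}_0$ is commuting if and only if it is a scalar multiple of $\sum_{i\geq 1}e^{i}_{i}$, i.e. if and only if there is $\lambda\in\mathbb{F}$ with $\phi(e_i)=\lambda e_i$ for all $i\geq 1$.
   Context: The ground field $\mathbb{F}$ is algebraically closed of characteristic zero. $\mathfrak{m}_0$ is the $\mathbb{N}$-graded Lie algebra over $\mathbb{F}$ with basis $\{e_i\mid i\geq 1\}$, $e_i$ homogeneous of degree $i$, whose only non-trivial brackets (up to skew-symmetry) are $[e_1,e_i]=e_{i+1}$ for all $i\geq 2$. A linear map $\phi$ of a Lie algebra $\mathfrak{g}$ to itself is called commuting if $[\phi(x),x]=0$ for every $x\in\mathfrak{g}$. The map $e_i^j$ is the linear map sending $e_i$ to $e_j$ and all other basis vectors to $0$; infinite sums are understood by evaluation on basis vectors. *)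

(* Defs.v *)
From HB Require Import structures.
From mathcomp Require Import all_boot all_order all_algebra.
From mathcomp Require Import ring.

Set Implicit Arguments.
Unset Strict Implicit.
Unset Printing Implicit Defensive.

Import GRing.Theory.
Local Open Scope ring_scope.

HB.mixin Record Lmodule_isLie (F : fieldType) L of GRing.Lmodule F L := {
  lie : L -> L -> L;
  lie_linearl : forall (a : F) (x y z : L),
    lie (a *: x + y) z = a *: lie x z + lie y z;
  lie_linearr : forall (a : F) (x y z : L),
    lie z (a *: x + y) = a *: lie z x + lie z y;
  liexx : forall x : L, lie x x = 0;
  lie_jacobi : forall x y z : L,
    lie x (lie y z) + lie y (lie z x) + lie z (lie x y) = 0
}.

#[short(type="lieType")]
HB.structure Definition LieAlgebra (F : fieldType) :=
  { L of GRing.Lmodule F L & Lmodule_isLie F L }.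

Definition commuting (F : fieldType) (L : lieType F) (phi : L -> L) : Prop :=
  forall x : L, lie (phi x) x = 0.

(* The underlying vector space of m_0 is F[X], used only as a vector space with
   a countable basis: its multiplicative structure is not inherited. *)
Definition m0 (F : fieldType) : Type := {poly F}.
HB.instance Definition _ (F : fieldType) := GRing.Lmodule.copy (m0 F) {poly F}.

(* Indices start at 1; e 0 is a junk value and is never used. *)
Definition e (F : fieldType) (i : nat) : m0 F := ('X^(i.-1) : {poly F}).
Arguments e {F} i.

(* The linear map sending e i to u i for all i >= 1. *)
Definition lin_ext (F : fieldType) (V : lmodType F) (u : nat -> V)
    (x : m0 F) : V :=
  \sum_(i < size (x : {poly F})) (x : {poly F})`_i *: u i.+1.

Definition m0_struct (F : fieldType) (i j : nat) : m0 F :=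
  if (i == 1)%N && (2 <= j)%N then e j.+1
  else if (j == 1)%N && (2 <= i)%N then - e i.+1
  else 0.

Definition m0_lie (F : fieldType) (x y : m0 F) : m0 F :=
  lin_ext (fun i => lin_ext (fun j => m0_struct F i j) y) x.

(* elem i j is the map written e_i^j: it sends e i to e j. *)
Definition elem (F : fieldType) (i j : nat) : m0 F -> m0 F :=
  lin_ext (fun k => if k == i then e j else 0).
Arguments elem {F} i j.

(* S is the infinite sum of the f i, i >= 1: on each basis vector the partial
   sums are eventually constant, with value that of S. *)
Definition is_basis_sum (F : fieldType) (f : nat -> m0 F -> m0 F)
    (S : m0 F -> m0 F) : Prop :=
  forall k : nat, (1 <= k)%N -> exists N : nat, forall n : nat, (N <= n)%N ->
    \sum_(1 <= i < n) f i (e k) = S (e k).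

Section Facts.
Variable F : fieldType.
Implicit Types x y z : m0 F.

Lemma lin_ext_widen (V : lmodType F) (u : nat -> V) x n :
  (size (x : {poly F}) <= n)%N ->
  lin_ext u x = \sum_(i < n) (x : {poly F})`_i *: u i.+1.
Proof.
move=> le_xn; rewrite /lin_ext (big_ord_widen n (fun i => (x : {poly F})`_i *: u i.+1)) //.
rewrite big_mkcond; apply: eq_bigr => i _.
by case: ltnP => // ?; rewrite nth_default // scale0r.
Qed.

Lemma lin_ext_is_linear (V : lmodType F) (u : nat -> V) : linear (lin_ext u).
Proof.
move=> a x y.
pose n := maxn (size ((a *: x + y : m0 F) : {poly F}))
  (maxn (size (x : {poly F})) (size (y : {poly F}))).
rewrite !(@lin_ext_widen _ _ _ n) ?leq_max ?leqnn ?orbT //.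
rewrite scaler_sumr -big_split; apply: eq_bigr => i _ /=.
by rewrite [X in X *: _](_ : _ = a * (x : {poly F})`_i + (y : {poly F})`_i) ?scalerDl ?scalerA // coefD coefZ.
Qed.

HB.instance Definition _ (V : lmodType F) (u : nat -> V) :=
  GRing.isLinear.Build F (m0 F) V _ (lin_ext u) (lin_ext_is_linear u).

HB.instance Definition _ i j := GRing.Linear.copy (@elem F i j)
  (lin_ext (fun k => if k == i then e j else 0 : m0 F)).

(* The next two lemmas say that (e i)_{i >= 1} is a basis. *)
Lemma lin_ext_e (V : lmodType F) (u : nat -> V) i :
  (1 <= i)%N -> lin_ext u (e i) = u i.
Proof.
case: i => // i _; rewrite /lin_ext /e /= size_polyXn big_ord_recr /= coefXn eqxx.
rewrite scale1r big1 ?add0r // => j _.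
by rewrite coefXn ltn_eqF ?scale0r // ltn_ord.
Qed.

Lemma lin_ext_unique (V : lmodType F) (g : {linear m0 F -> V}) x :
  g x = lin_ext (fun i => g (e i)) x.
Proof.
rewrite -[in LHS](coefK x) poly_def linear_sum; apply: eq_bigr => i _.
exact: linearZ.
Qed.

Lemma m0_lie_e i j : (1 <= i)%N -> (1 <= j)%N ->
  m0_lie (e i) (e j) = m0_struct F i j.
Proof. by move=> i1 j1; rewrite /m0_lie !lin_ext_e. Qed.

Lemma m0_lie_graded i j : (1 <= i)%N -> (1 <= j)%N ->
  exists a : F, m0_lie (e i) (e j) = a *: e (i + j).
Proof.
move=> i1 j1; rewrite m0_lie_e // /m0_struct.
case: ifP => [/andP[/eqP-> _]|_]; first by exists 1; rewrite scale1r.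
case: ifP => [/andP[/eqP-> _]|_]; first by exists (-1); rewrite scaleN1r addn1.
by exists 0; rewrite scale0r.
Qed.

Lemma m0_lieE x y : m0_lie x y =
  'X * ((x : {poly F})`_0 *: (y : {poly F}) - (y : {poly F})`_0 *: (x : {poly F})).
Proof.
pose n := (maxn (size (x : {poly F})) (size (y : {poly F}))).+1.
have sx : (size (x : {poly F}) <= n)%N by rewrite leqW // leq_max leqnn.
have sy : (size (y : {poly F}) <= n)%N by rewrite leqW // leq_max leqnn orbT.
have pE (p : {poly F}) : (size p <= n)%N ->
    p = (p`_0)%:P + \sum_(i < n.-1) p`_i.+1 *: 'X^(i.+1).
  move=> sp; rewrite -[LHS]coefK -(alg_polyC (p`_0)).
  transitivity (\sum_(i < n) p`_i *: 'X^i); last by rewrite big_ord_recl expr0.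
  by rewrite poly_def; have := @lin_ext_widen _ (fun i => 'X^(i.-1) : {poly F}) p n sp.
rewrite /m0_lie (lin_ext_widen _ sx) big_ord_recl /=.
have r1 : lin_ext (fun j => m0_struct F 1 j) y =
    'X * \sum_(i < n.-1) (y : {poly F})`_i.+1 *: 'X^(i.+1).
  rewrite (lin_ext_widen _ sy) big_ord_recl /= scaler0 add0r mulr_sumr.
  by apply: eq_bigr => i _; rewrite -scalerAr -exprS.
have r2 (i : 'I_n.-1) : lin_ext (fun j => m0_struct F i.+2 j) y =
    - ((y : {poly F})`_0 *: 'X^(i.+2)).
  rewrite (lin_ext_widen _ sy) big_ord_recl /= big1 ?addr0 ?scalerN //.
  by move=> j _; rewrite /m0_struct /= scaler0.
rewrite r1; under eq_bigr => i _ do rewrite r2.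
have yxE : (x : {poly F})`_0 *: (y : {poly F}) - (y : {poly F})`_0 *: (x : {poly F}) =
    (x : {poly F})`_0 *: \sum_(i < n.-1) (y : {poly F})`_i.+1 *: 'X^(i.+1)
    - (y : {poly F})`_0 *: \sum_(i < n.-1) (x : {poly F})`_i.+1 *: 'X^(i.+1).
  have := pE _ sy; have := pE _ sx; rewrite -!mul_polyC.
  set A := \sum_(i < n.-1) _; set B := \sum_(i < n.-1) _ => xE yE.
  by rewrite [X in _ * X - _]yE [X in _ - _ * X]xE; ring.
rewrite yxE mulrBr -scalerAr; congr (_ + _).
rewrite scaler_sumr mulr_sumr -sumrN; apply: eq_bigr => i _.
by rewrite scalerN -!scalerAr -exprS !scalerA mulrC.
Qed.

Lemma m0_lie_coef0 x y : (m0_lie x y : {poly F})`_0 = 0.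
Proof. by rewrite m0_lieE coefXM. Qed.

Lemma m0_lie_linearl (a : F) x y z :
  m0_lie (a *: x + y) z = a *: m0_lie x z + m0_lie y z.
Proof. exact: linearP. Qed.

Lemma m0_liexx x : m0_lie x x = 0.
Proof. by rewrite m0_lieE subrr mulr0. Qed.

Lemma m0_lieC x y : m0_lie x y = - m0_lie y x.
Proof. by rewrite !m0_lieE -mulrN opprB. Qed.

Lemma m0_lie_linearr (a : F) x y z :
  m0_lie z (a *: x + y) = a *: m0_lie z x + m0_lie z y.
Proof.
by rewrite m0_lieC m0_lie_linearl (m0_lieC x) (m0_lieC y) scalerN opprD !opprK.
Qed.

Lemma m0_lie_jacobi x y z :
  m0_lie x (m0_lie y z) + m0_lie y (m0_lie z x) + m0_lie z (m0_lie x y) = 0.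
Proof.
have lie2 u v w : m0_lie u (m0_lie v w) =
    'X * ('X * (((u : {poly F})`_0)%:P *
      (((v : {poly F})`_0)%:P * w - ((w : {poly F})`_0)%:P * v))).
  rewrite (m0_lieE u) m0_lie_coef0 scale0r subr0 m0_lieE -!mul_polyC.
  by congr (_ * _); rewrite mulrCA.
rewrite !lie2; set a := _%:P; set b := _%:P; set c := _%:P.
by rewrite -!mulrDr [X in 'X * ('X * X)](_ : _ = 0 :> {poly F}) ?mulr0 //; ring.
Qed.

HB.instance Definition _ := Lmodule_isLie.Build F (m0 F)
  m0_lie_linearl m0_lie_linearr m0_liexx m0_lie_jacobi.

End Facts.

(* Main.v *)
Require Import Defs.
From HB Require Import structures.
From mathcomp Require Import all_boot all_order all_algebra.

Import GRing.Theory.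
Local Open Scope ring_scope.

(** Under the identification of m_0 with F[X], the bracket of x and y vanishes
    iff x_0 y = y_0 x, where x_0 is the coordinate along e_1.  Taking y = e_1 and
    x = phi(e_1) gives phi(e_1) = lambda e_1; taking y = e_k with k >= 2 shows that
    phi(e_k) has no e_1-component; and y = e_1 + e_k then forces
    phi(e_k) = lambda e_k. *)

(** By [m0_lieE] the bracket is ['X] times a polynomial, and [{poly F}] is an integral domain. *)
Lemma lie_m0_eq0 (F : fieldType) (x y : m0 F) :
  lie x y = 0 <->
  (x : {poly F})`_0 *: (y : {poly F}) = (y : {poly F})`_0 *: (x : {poly F}).
Proof.
rewrite [lie x y]m0_lieE; split=> [/eqP | ->]; last by rewrite subrr mulr0.
by rewrite mulf_eq0 polyX_eq0 /= subr_eq0 => /eqP.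
Qed.

Lemma linear_m0_eq (F : fieldType) (V : lmodType F) (f g : {linear m0 F -> V}) :
  (forall i, (1 <= i)%N -> f (e i) = g (e i)) -> f =1 g.
Proof.
move=> eq_fg x; rewrite (lin_ext_unique f) (lin_ext_unique g).
by apply: eq_bigr => i _; rewrite eq_fg.
Qed.

Lemma sum_elem_diag_e (F : fieldType) (k n : nat) :
  (1 <= k < n)%N -> \sum_(1 <= i < n) elem i i (e k) = e k :> m0 F.
Proof.
move=> /andP[k1 kn]; rewrite (bigD1_seq k) ?mem_index_iota ?k1 ?iota_uniq //=.
rewrite /elem lin_ext_e // eqxx big1 ?addr0 // => i ik.
by rewrite lin_ext_e // eq_sym (negPf ik).
Qed.

(** At [e k] only the term [i = k] survives, so the partial sums are constant from [n = k.+1] on. *)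
Lemma is_basis_sum_elem_diag (F : fieldType) (S : m0 F -> m0 F) :
  is_basis_sum (fun i => elem i i) S <->
  (forall k, (1 <= k)%N -> S (e k) = e k).
Proof.
split=> [sumS k k1 | Se k k1].
  have [N /(_ (maxn N k.+1) (leq_maxl _ _)) <-] := sumS k k1.
  by rewrite sum_elem_diag_e // k1 leq_maxr.
by exists k.+1 => n kn; rewrite sum_elem_diag_e ?Se ?k1.
Qed.

Lemma commuting_m0P (F : fieldType) (phi : {linear m0 F -> m0 F}) :
  commuting phi <-> exists lambda : F, forall x, phi x = lambda *: x.
Proof.
split=> [com | [lambda phiE] x]; last first.
  by apply/lie_m0_eq0; rewrite phiE coefZ scalerA [(x : {poly F})`_0 * _]mulrC.
have coefE (x : m0 F) := (lie_m0_eq0 F (phi x) x).1 (com x).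
pose lambda : F := (phi (e 1) : {poly F})`_0.
have phi1 : phi (e 1) = lambda *: e 1.
  by have := coefE (e 1); rewrite coefXn scale1r.
exists lambda; apply: (linear_m0_eq _ _ phi ( *:%R lambda)) => -[|[|k]] // _.
have phik0 : (phi (e k.+2) : {poly F})`_0 = 0.
  (* [e k.+2] is ['X^(k.+1)]: its constant coefficient is 0, which kills the right-hand side, yet it
     is itself nonzero. *)
  have /eqP := coefE (e k.+2).
  by rewrite coefXn scale0r scaler_eq0 -size_poly_eq0 size_polyXn orbF => /eqP.
have := coefE (e 1 + e k.+2).
(* Both constant coefficients come from [e 1] alone: [lambda] on the left, 1 on the right. The
   common summand [lambda *: e 1] then cancels. *)
rewrite (linearD phi) !coefD phik0 addr0 !coefXn addr0 scale1r.
by rewrite -/lambda scalerDr phi1 => /addrI <-.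
Qed.

Theorem theorem2p2 (F : closedFieldType) (charF0 : [pchar F] =i pred0)
    (phi : {linear m0 F -> m0 F}) :
  (commuting phi <->
     exists (lambda : F) (S : {linear m0 F -> m0 F}),
       is_basis_sum (fun i => elem i i) S /\
       (forall x : m0 F, phi x = lambda *: S x)) /\
  (commuting phi <->
     exists lambda : F, forall i : nat, (1 <= i)%N ->
       phi (e i) = lambda *: e i).
Proof.
split; split=> [/commuting_m0P[lambda phiE] | ].
(* The infinite sum of the [elem i i] is the identity. *)
- by exists lambda, idfun; split; first exact/is_basis_sum_elem_diag.
- move=> [lambda [S [/is_basis_sum_elem_diag Se phiE]]].
  apply/commuting_m0P; exists lambda => x.
  by rewrite phiE (linear_m0_eq _ _ S idfun).
- by exists lambda.
- move=> [lambda phie]; apply/commuting_m0P; exists lambda.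
  exact: (linear_m0_eq _ _ phi ( *:%R lambda)).
Qed.
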